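(* Let $n$, $i$, $k$ be positive integers with $n \geqslant 2$, $k<n$ and $i \leqslant n$. Let \[ S(n,i,k)=\sum_{\substack{1 \leqslant i_1<i_2<\cdots<i_k \leqslant n,\\ i_j \neq i \text{ for } j=1,2,\ldots,k}} \frac{1}{i_1 i_2 \cdots i_k} \] be the $k$-th elementary symmetric function of the numbers in $\{1,1/2,\ldots,1/n\}\setminus\{1/i\}$. Then $S(n,i,k)$ is not an integer unless $(n,i,k)=(2,2,1)$ or $(n,i,k)=(4,4,2)$.
   Context: For integers $n,i,k$ with $1\leqslant k<n$ and $1\leqslant i\leqslant n$, $S(n,i,k)$ denotes the $k$-th elementary symmetric function of the $n-1$ numbers $\{1,1/2,\ldots,1/n\}\setminus\{1/i\}$, i.e. the sum of $1/(i_1 i_2\cdots i_k)$ over all $1\leqslant i_1<\cdots<i_k\leqslant n$ with no $i_j$ equal to $i$. *)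

(* Defs.v *)
From mathcomp Require Import all_boot all_order all_algebra.
Set Implicit Arguments. Unset Strict Implicit. Unset Printing Implicit Defensive.
Import Order.TTheory GRing.Theory Num.Theory.
Local Open Scope ring_scope.

Definition S (n i k : nat) : rat :=
  \sum_(A : {set 'I_n.+1} |
          [&& #|A| == k, (ord0 \notin A) & [forall j in A, nat_of_ord j != i]])
     \prod_(j in A) (j%:R)^-1.

(* Main.v *)
(* Write [T n i k] for the sum in question. For a prime [p] not dividing [i] and
   [m := n %/ p >= k], the terms all of whose factors are multiples of [p]
   dominate [p]-adically, so if [T n i k] is an integer then [p] divides the
   numerator [c(m+1, k+1)] (a Stirling number) of the [k]-th symmetric function
   of [1, ..., 1/m]. Hence every prime [p <= n / k] with
   [p] not dividing [c(n %/ p + 1, k+1)] divides [i], and primes with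
   product greater than [n] give a contradiction.

   If [k] is large compared with [log n], then [T n i k < 1] because the [k]-th
   symmetric function is at most [H_n^k / k!]. Otherwise:
   - for [n >= 2^23] put [X := n %/ (2k)]; all primes in [(X, 2X]] divide
     [i * \prod_(k <= m < 2k) c(m+1, k+1)], which is too small for the
     Erdos lower bound on the product of these primes;
   - for [2^10 <= n < 2^23] a list of 64 primes always contains suitable
     ones, as each [p] works on whole intervals [mp <= n < (m+1)p];
   - for [n <= 2^10] the primes may leave some [i] open, and then a fixed-point
     enclosure of [T n i k] is checked to contain no integer. *)
From Stdlib Require Import NArith.
Require Import Defs.
From mathcomp Require Import all_boot all_order all_algebra.
From mathcomp Require Import zify ring lra.
Import Order.TTheory GRing.Theory Num.Theory.
Local Open Scope ring_scope.

(** * Elementary symmetric functions of reciprocals as polynomial coefficients *)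

Definition esym_poly (s : seq nat) : {poly rat} :=
  \prod_(j <- s) (1 + (j%:R^-1) *: 'X).

Definition omit (n i : nat) : seq nat := [seq j <- iota 1 n | j != i].

Lemma coef_esym_cons j s k :
  (esym_poly (j :: s))`_k.+1 = (esym_poly s)`_k.+1 + j%:R^-1 * (esym_poly s)`_k.
Proof.
by rewrite /esym_poly big_cons mulrDl mul1r coefD -scalerAl coefZ coefXM.
Qed.

Lemma coef0_esym s : (esym_poly s)`_0 = 1.
Proof.
elim: s => [|j s IH]; first by rewrite /esym_poly big_nil coef1.
rewrite /esym_poly big_cons mulrDl mul1r coefD -scalerAl coefZ coefXM /=.
by rewrite mulr0 addr0.
Qed.

Lemma perm_esym s t : perm_eq s t -> esym_poly s = esym_poly t.
Proof. exact: perm_big. Qed.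

Lemma esym_ge0 s k : 0 <= (esym_poly s)`_k.
Proof.
elim: s k => [|j s IH] [|k]; rewrite ?coef0_esym // ?coef_esym_cons.
  by rewrite /esym_poly big_nil coef1.
by rewrite addr_ge0 ?mulr_ge0 ?invr_ge0 ?ler0n.
Qed.

(** With weight 0 on [i] and on 0, the product over all of ['I_n.+1] expands over all subsets, and
    those containing [i] or 0 drop out. *)
Lemma S_esym n i k : S n i k = (esym_poly (omit n i))`_k.
Proof.
pose x (j : 'I_n.+1) : rat := if nat_of_ord j == i then 0 else j%:R^-1.
have -> : esym_poly (omit n i) = \prod_(j < n.+1) (x j *: 'X + 1).
  rewrite /esym_poly /omit big_filter.
  rewrite (_ : iota 1 n = index_iota 1 n.+1); last by rewrite /index_iota subn1.
  rewrite big_mkcond /=.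
  rewrite -(big_mkord predT (fun j => (if j == i then 0 else j%:R^-1 : rat) *: 'X + 1)).
  rewrite [RHS]big_ltn // mulr0n invr0 if_same scale0r add0r mul1r.
  apply: eq_bigr => j _; rewrite addrC; case: eqP => //= _.
  by rewrite scale0r add0r.
rewrite bigA_distr /= coef_sum.
have H (A : {set 'I_n.+1}) :
  (\prod_(j < n.+1) (if j \in A then x j *: 'X else 1))`_k
  = if #|A| == k then \prod_(j in A) x j else 0.
  rewrite -big_mkcond /= scaler_prod prodr_const coefZ coefXn eq_sym.
  by case: eqP; rewrite ?mulr1 ?mulr0.
under eq_bigr do rewrite H.
pose good (A : {set 'I_n.+1}) :=
  (ord0 \notin A) && [forall j in A, nat_of_ord j != i].
rewrite -big_mkcond /= /S [RHS](bigID good) /=.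
rewrite [X in _ = _ + X]big1 ?addr0; last first.
  move=> A /andP [_]; rewrite /good negb_and negbK => /orP [h|].
    rewrite (bigD1 ord0) //= /x; case: eqP => _; rewrite ?mul0r //.
    by rewrite invr0 mul0r.
  rewrite negb_forall => /existsP [j]; rewrite negb_imply negbK => /andP [jA ji].
  by rewrite (bigD1 j) //= /x ji mul0r.
apply: eq_big => [A|A]; first by [].
case/and3P => _ _ /forallP h; apply: eq_bigr => j jA.
by rewrite /x; have := h j; rewrite jA /= => /negbTE ->.
Qed.

Lemma harmonicS n k :
  (esym_poly (iota 1 n.+1))`_k.+1
  = (esym_poly (iota 1 n))`_k.+1 + (n.+1)%:R^-1 * (esym_poly (iota 1 n))`_k.
Proof.
rewrite -coef_esym_cons (@perm_esym _ (n.+1 :: iota 1 n)) //.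
have -> : iota 1 n.+1 = rcons (iota 1 n) n.+1.
  by rewrite -cats1 -{1}(addn1 n) iotaD.
by rewrite perm_rcons.
Qed.

(** The full polynomial is that of [omit n i] times [1 + X/i]. *)
Lemma omit_recr n i k : (0 < i <= n)%N ->
  (esym_poly (iota 1 n))`_k.+1
  = (esym_poly (omit n i))`_k.+1 + i%:R^-1 * (esym_poly (omit n i))`_k.
Proof.
move=> hi; rewrite -coef_esym_cons (@perm_esym _ (i :: omit n i)) //.
rewrite /omit -rem_filter ?iota_uniq //.
by apply: perm_to_rem; rewrite mem_iota; lia.
Qed.

Lemma omit_le n i k : (0 < i <= n)%N ->
  (esym_poly (omit n i))`_k <= (esym_poly (iota 1 n))`_k.
Proof.
case: k => [|k] hi; first by rewrite !coef0_esym.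
by rewrite (omit_recr _ _ _ hi) lerDl mulr_ge0 ?invr_ge0 ?ler0n ?esym_ge0.
Qed.

Lemma esym_gt0 s k : 0%N \notin s -> (k <= size s)%N -> 0 < (esym_poly s)`_k.
Proof.
elim: s k => [|j s IH] [|k]; rewrite ?coef0_esym //=.
rewrite in_cons negb_or => /andP [j0 s0] ks; rewrite coef_esym_cons.
rewrite ltr_wpDl ?esym_ge0 // mulr_gt0 ?IH // invr_gt0 ltr0n; lia.
Qed.

Lemma size_omit n i : (0 < i <= n)%N -> size (omit n i) = n.-1.
Proof.
move=> hi; rewrite /omit -rem_filter ?iota_uniq //.
by rewrite size_rem ?size_iota // mem_iota; lia.
Qed.

(** In [e_1 e_k] each product of [k+1] entries at distinct positions arises [k+1] times, and the
    remaining terms are nonnegative. *)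
Lemma esym_newton s k :
  k.+1%:R * (esym_poly s)`_k.+1 <= (esym_poly s)`_1 * (esym_poly s)`_k.
Proof.
elim: s k => [|j s IH] k.
  by rewrite /esym_poly big_nil !coef1 mulr0 /= mul0r.
have x0 : 0 <= j%:R^-1 :> rat by rewrite invr_ge0 ler0n.
rewrite !(coef_esym_cons _ _ 0) !(coef_esym_cons _ _ k) coef0_esym mulr1.
case: k => [|k]; first by rewrite !coef0_esym; lra.
rewrite coef_esym_cons; move: (_^-1) x0 => x x0.
have h1 := IH k.+1; have h2 := IH k.
have e0 := esym_ge0 s k.
move: h1 h2 e0; rewrite -!natr1.
move: (k%:R) (_`_1) (_`_k.+2) (_`_k.+1) (_`_k) => c a e2 e1 e h1 h2 e0.
(* The claim is [h1] plus [x] times [h2] plus [0 <= x^2 e]. *)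
have : x * ((c + 1) * e1) <= x * (a * e) by rewrite ler_wpM2l.
have : 0 <= x * x * e by rewrite !mulr_ge0.
nra.
Qed.

Lemma esym_power_bound s k :
  k`!%:R * (esym_poly s)`_k <= (esym_poly s)`_1 ^+ k.
Proof.
elim: k => [|k IH]; first by rewrite coef0_esym fact0 expr0 mulr1.
rewrite factS mulnC natrM -mulrA exprS.
apply: le_trans (_ : k`!%:R * ((esym_poly s)`_1 * (esym_poly s)`_k) <= _).
  by rewrite ler_wpM2l ?ler0n ?esym_newton.
by rewrite mulrCA ler_wpM2l ?esym_ge0.
Qed.

(** * Bounds for harmonic numbers, and sums below 1 *)

Local Notation harmonic n := ((esym_poly (iota 1 n))`_1).

Lemma harmonicS1 n : harmonic n.+1 = harmonic n + (n.+1)%:R^-1.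
Proof. by rewrite harmonicS coef0_esym mulr1. Qed.

Lemma harmonic_le m n : (m <= n)%N -> harmonic m <= harmonic n.
Proof.
move=> /subnKC <-; elim: (n - m)%N => [|d IH]; first by rewrite addn0.
by rewrite addnS harmonicS1 (le_trans IH) // lerDl invr_ge0 ler0n.
Qed.

(* [harmonic (2n) - harmonic n] increases with [n], but adding [1/(4n)] makes
   it decreasing. *)
Lemma harmonic_double n : (0 < n)%N -> harmonic n.*2 <= harmonic n + 3%:R / 4%:R.
Proof.
case: n => // n _.
suff h : harmonic n.+1.*2 + (4 * n.+1)%:R^-1 <= harmonic n.+1 + 3%:R / 4%:R.
  by apply: le_trans h; rewrite lerDl invr_ge0 ler0n.
elim: n => [|n IH].
  by rewrite (_ : 1.*2 = 2%N) // !harmonicS1 /= /esym_poly big_nil coef1 /=; lra.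
rewrite doubleS 2!harmonicS1 [X in _ <= X + _]harmonicS1.
move: IH; move: (harmonic _) (harmonic _) => a b.
suff : (n.+1.*2.+1)%:R^-1 + (n.+1.*2.+2)%:R^-1 + (4 * n.+2)%:R^-1
   <= n.+2%:R^-1 + (4 * n.+1)%:R^-1 :> rat.
  by move: (_%:R^-1) (_%:R^-1) (_%:R^-1) (_%:R^-1) (_%:R^-1) => *; lra.
have -> : (n.+1.*2.+2 = 2 * n + 4)%N by lia.
have -> : (n.+1.*2.+1 = 2 * n + 3)%N by lia.
have -> : (n.+2 = n + 2)%N by lia.
have -> : (n.+1 = n + 1)%N by lia.
rewrite !(natrM _ 4) !(natrD _ (2 * n)) (natrM _ 2 n) !(natrD _ n).
have: 0 <= n%:R :> rat by rewrite ler0n.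
move: n%:R => c c0; rewrite -subr_ge0.
have -> : (c + 2)^-1 + (4 * (c + 1))^-1
    - ((2 * c + 3)^-1 + (2 * c + 4)^-1 + (4 * (c + 2))^-1)
  = (2 * c + 3)^-1 * (4 * (c + 1) * (c + 2))^-1 :> rat.
  by field; apply/and4P; split; lra.
by rewrite mulr_ge0 // invr_ge0; nra.
Qed.

(** Each doubling adds at most [3/4 = 15/20] to the value at [2^10]. The bound on that value is a
    hypothesis here because [check_rows] certifies it later. *)
Lemma harmonic_pow2 b : (10 <= b)%N -> harmonic (2 ^ 10) <= 152%:R / 20%:R ->
  harmonic (2 ^ b) <= (2 + 15 * b)%:R / 20%:R.
Proof.
move=> hb h0; rewrite -(subnKC hb); elim: (b - 10)%N => [|d IH].
  by rewrite addn0.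
rewrite addnS expnS mul2n; apply: le_trans (harmonic_double _ _) _.
  by rewrite expn_gt0.
have -> : (2 + 15 * (10 + d).+1 = (2 + 15 * (10 + d)) + 15)%N by lia.
rewrite natrD; move: IH; move: (harmonic _) (_%:R) => x y; lra.
Qed.

Lemma esym_lt1 s k (a b : nat) : (0 < b)%N ->
  (esym_poly s)`_1 <= a%:R / b%:R -> (a ^ k < k`! * b ^ k)%N ->
  (esym_poly s)`_k < 1.
Proof.
move=> b0 hs hk; have f0 : 0 < k`!%:R :> rat by rewrite ltr0n fact_gt0.
have b0' : 0 < b%:R :> rat by rewrite ltr0n.
rewrite -(ltr_pM2l f0) mulr1; apply: le_lt_trans (esym_power_bound _ _) _.
apply: le_lt_trans (_ : (a%:R / b%:R) ^+ k < _).
  by rewrite lerXn2r // ?nnegrE ?esym_ge0 // divr_ge0 ?ler0n.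
by rewrite expr_div_n ltr_pdivrMr ?exprn_gt0 // -!natrX -natrM ltr_nat.
Qed.

(** Since [k <= n - 1], the sum is positive, and it is at most the sum without omission. *)
Lemma omit_not_int n i k : (0 < i <= n)%N -> (k < n)%N ->
  (esym_poly (iota 1 n))`_k < 1 -> (esym_poly (omit n i))`_k \isn't a Num.int.
Proof.
move=> hi hk h; apply/negP => /intrP [z hz].
have := le_lt_trans (omit_le _ _ k hi) h; rewrite hz.
have : 0 < (esym_poly (omit n i))`_k.
  apply: esym_gt0; last by rewrite size_omit //; lia.
  by rewrite mem_filter mem_iota andbF.
by rewrite hz ltr0z -[1]/(1%:~R) ltr_int; lia.
Qed.

(** * Stirling numbers and primes not dividing the omitted index *)

(* Unsigned Stirling numbers of the first kind, shifted by one: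
   [stirling m k] is the coefficient of [X^k] in [(X + 1) ... (X + m)]. *)
Fixpoint stirling (m k : nat) : nat :=
  match m, k with
  | 0, 0 => 1
  | 0, _.+1 => 0
  | m'.+1, 0 => m * stirling m' 0
  | m'.+1, k'.+1 => m * stirling m' k + stirling m' k'
  end%N.

Lemma stirling_small m k : (m < k)%N -> stirling m k = 0%N.
Proof.
elim: m k => [|m IH] [|k] //= mk.
by rewrite !IH ?muln0 //; lia.
Qed.

Lemma stirling_gt0 m k : (k <= m)%N -> (0 < stirling m k)%N.
Proof.
elim: m k => [|m IH] [|k] //= km; first by rewrite muln_gt0 IH.
by rewrite addn_gt0 (IH k) ?orbT.
Qed.

(** The coefficients of [(X+1)...(X+m)] add up to its value [(m+1)!] at 1. *)
Lemma stirling_le m k : (stirling m k <= m.+1`!)%N.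
Proof.
elim: m k => [|m IH] [|k] //=; rewrite factS.
  by apply: leq_mul => //; rewrite ltnW.
by have := IH k; have := IH k.+1; nia.
Qed.

(** This is [esym_poly] with denominators cleared, so that divisibility by powers of a prime makes
    sense. *)
Definition shift_poly (s : seq nat) : {poly nat} :=
  \prod_(j <- s) (j%:P + 'X).

Local Notation shift_coef s k := ((shift_poly s)`_k)%R.

Lemma coef_shift_cons j s k :
  shift_coef (j :: s) k.+1 = (j * shift_coef s k.+1 + shift_coef s k)%N.
Proof. by rewrite /shift_poly big_cons mulrDl coefD coefCM coefXM. Qed.

Lemma coef0_shift_cons j s :
  shift_coef (j :: s) 0 = (j * shift_coef s 0)%N.
Proof. by rewrite /shift_poly big_cons mulrDl coefD coefCM coefXM /= addr0. Qed.

Lemma coef0_shift s : shift_coef s 0 = (\prod_(j <- s) j)%N.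
Proof.
elim: s => [|j s IH]; first by rewrite /shift_poly !big_nil coef1.
by rewrite coef0_shift_cons IH big_cons.
Qed.

Lemma shift_esym s k : 0%N \notin s ->
  (shift_coef s k)%:R = (\prod_(j <- s) j)%N%:R * (esym_poly s)`_k :> rat.
Proof.
elim: s k => [|j s IH] k.
  by rewrite /shift_poly /esym_poly !big_nil !coef1 mul1r; case: k.
rewrite in_cons negb_or => /andP [j0 s0].
have jn : j%:R != 0 :> rat by rewrite pnatr_eq0; lia.
case: k => [|k]; first by rewrite coef0_shift coef0_esym mulr1.
rewrite coef_shift_cons coef_esym_cons big_cons natrD !natrM !IH //.
by field.
Qed.

Lemma shift_perm s t : perm_eq s t -> shift_poly s = shift_poly t.
Proof. exact: perm_big. Qed.

(** Putting [pX] for [X] gives [p^m (X+1)...(X+m)]; compare the coefficients of [X^k]. *)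
Lemma shift_scaled p m k :
  shift_coef [seq (p * l)%N | l <- iota 1 m] k = (p ^ (m - k) * stirling m k)%N.
Proof.
elim: m k => [|m IH] k.
  by rewrite /shift_poly big_nil coef1; case: k.
rewrite (@shift_perm _ ((p * m.+1)%N :: [seq (p * l)%N | l <- iota 1 m])); last first.
  have -> : iota 1 m.+1 = rcons (iota 1 m) m.+1.
    by rewrite -cats1 -{1}(addn1 m) iotaD.
  by rewrite map_rcons perm_rcons.
case: k => [|k].
  by rewrite coef0_shift_cons IH /= !subn0 expnS; lia.
rewrite coef_shift_cons !IH subSS [in RHS]/= -/stirling.
(* For [m <= k] the exponent [m - k.+1] is truncated, but its cofactor [stirling m k.+1]
   vanishes. *)
have [km|mk] := ltnP k m.
  by have := subnSK km; move: (m - k.+1)%N => d <-; rewrite expnS; nia.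
by rewrite [stirling m k.+1]stirling_small // !muln0 add0n.
Qed.

(** The coefficient is a sum over [j <= k] in which the multiples of [p] contribute
    [p^(m-j) stirling m j]. The terms with [j < k] are divisible by [p^(m-k+1)], and so is the whole
    because [k > 0]; hence so is the term [j = k]. *)
Lemma dvdn_shift_stirling p m k (s : seq nat) : (0 < k)%N -> (k <= m)%N ->
  (p ^ m %| shift_coef ([seq (p * l)%N | l <- iota 1 m] ++ s) k)%N ->
  prime p -> (p %| stirling m k * \prod_(j <- s) j)%N.
Proof.
move=> k0 km h pp.
have : (p ^ (m - k).+1 %| shift_coef ([seq (p * l)%N | l <- iota 1 m] ++ s) k)%N.
  by apply: dvdn_trans h; apply: dvdn_exp2l; lia.
rewrite /shift_poly big_cat -!/(shift_poly _) coefM big_ord_recr /= subnn.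
rewrite coef0_shift shift_scaled dvdn_addr; last first.
  apply: (big_ind (fun x : nat => p ^ (m - k).+1 %| x)%N) => // [x y|i _].
    exact: dvdn_add.
  rewrite shift_scaled; apply/dvdn_mulr/dvdn_mulr/dvdn_exp2l.
  by have := ltn_ord i; lia.
rewrite -[(_ * _)%R]/(_ * _)%N expnSr -mulnA dvdn_pmul2l // expn_gt0.
by rewrite (prime_gt0 pp).
Qed.

(** As [p] does not divide [i], no multiple of [p] was left out. *)
Lemma omit_multiples n i p : prime p -> ~~ (p %| i)%N ->
  perm_eq (omit n i)
    ([seq (p * l)%N | l <- iota 1 (n %/ p)%N] ++ [seq j <- omit n i | ~~ (p %| j)%N]).
Proof.
move=> pp pi; have p0 := prime_gt0 pp.
rewrite -(perm_filterC (fun j => p %| j)%N (omit n i)) perm_cat2r.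
apply: uniq_perm => [||j]; first by rewrite !filter_uniq ?iota_uniq.
  by rewrite map_inj_uniq ?iota_uniq // => x y /eqP; rewrite eqn_pmul2l // => /eqP.
rewrite !mem_filter mem_iota; apply/idP/mapP => [/and3P [/dvdnP [l ->]] _ hl|[l]].
  exists l; last by rewrite mulnC.
  by rewrite mem_iota add1n ltnS leq_divRL //; move: hl; rewrite muln_gt0; lia.
rewrite mem_iota add1n ltnS leq_divRL // => hl ->.
rewrite dvdn_mulr //=; apply/andP; split; last by rewrite muln_gt0; lia.
by apply: contraNneq pi => <-; rewrite dvdn_mulr.
Qed.

(* Among the reciprocals, those of the multiples of [p] dominate [p]-adically:
   the [p^-k]-part of the sum is the [k]-th symmetric function of
   [1, 1/2, ..., 1/(n %/ p)]. *)
Lemma prime_dvd_stirling n i k p : prime p -> ~~ (p %| i)%N ->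
  (0 < k)%N -> (k <= n %/ p)%N -> (esym_poly (omit n i))`_k \is a Num.int ->
  (p %| stirling (n %/ p) k)%N.
Proof.
move=> pp pi k0 kn /intrP [z hz].
have s0 : 0%N \notin omit n i by rewrite mem_filter mem_iota andbF.
have := shift_esym _ k s0; rewrite hz.
have z0 : (0 <= z)%R by rewrite -(@ler0z rat) -hz esym_ge0.
case: z hz z0 => // c hz _ /eqP; rewrite -natrM eqr_nat => /eqP hc.
have hperm := @omit_multiples n i p pp pi.
have := @dvdn_shift_stirling p (n %/ p) k [seq j <- omit n i | ~~ (p %| j)%N] k0 kn.
rewrite -(shift_perm _ _ hperm) hc (perm_big _ hperm) /= big_cat big_map /=.
set m := (n %/ p)%N; set r := (\prod_(_ <- filter _ _) _)%N.
(* The multiples of [p] supply the factor [p^m] that [dvdn_shift_stirling] asks for. *)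
have -> : (\prod_(l <- iota 1 m) (p * l) = p ^ m * \prod_(l <- iota 1 m) l)%N.
  have -> : iota 1 m = index_iota 1 m.+1 by rewrite /index_iota subn1.
  by rewrite big_split /= prod_nat_const_nat subn1.
rewrite -!mulnA dvdn_mulr // => /(_ isT pp); rewrite Euclid_dvdM // => /orP [//|].
(* The product [r] of the remaining numbers is prime to [p]. *)
rewrite /r (Euclid_dvd_prod _ _ _ pp) big_has => /hasP [j].
by rewrite mem_filter => /andP [/negbTE ->].
Qed.

Local Open Scope nat_scope.

(** * Products of primes and the case of large [n] *)

Lemma prod_primes_dvdn a b d :
  (forall p, prime p -> a <= p < b -> p %| d) ->
  \prod_(a <= p < b | prime p) p %| d.
Proof.
have [ba _|ab] := leqP b a; first by rewrite big_geq.
elim: b ab => // b IH ab h.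
rewrite big_mkcond big_nat_recr //= -big_mkcond /=.
have hd : \prod_(a <= p < b | prime p) p %| d.
  have [ba|ab'] := leqP b a; first by rewrite big_geq.
  by apply: IH => // p pp hp; apply: h => //; lia.
case: ifP => [pb|_]; last by rewrite muln1.
rewrite Gauss_dvd ?hd ?h //; first by lia.
rewrite coprime_sym prime_coprime // big_seq_cond Euclid_dvd_prod // big_has_cond.
apply/negP => /hasP [p]; rewrite mem_index_iota => hp /andP [/andP [_ pp]].
by rewrite dvdn_prime2 //; lia.
Qed.

Definition primorial n := \prod_(0 <= p < n.+1 | prime p) p.

Lemma prime_dvd_fact p n : prime p -> p %| n`! -> p <= n.
Proof.
move=> pp; elim: n => [|n IH]; first by rewrite fact0 Euclid_dvd1.
by rewrite factS Euclid_dvdM // => /orP [/dvdn_leq ->|/IH /leqW].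
Qed.

(** The two equal middle coefficients together are at most [2^(2m+1)]. *)
Lemma bin_odd_le m : 'C(m.*2.+1, m) <= 4 ^ m.
Proof.
have := expnDn 1 1 m.*2.+1; under eq_bigr do rewrite !exp1n !muln1.
rewrite addn1 (bigD1 (inord m)) //= (bigD1 (inord m.+1)) /=; last first.
  by apply/eqP => /(congr1 val); rewrite /= !inordK; lia.
rewrite !inordK; [| lia..].
have -> : 'C(m.*2.+1, m.+1) = 'C(m.*2.+1, m).
  by rewrite -bin_sub; [congr 'C(_, _)|]; lia.
move=> h; rewrite -(leq_pmul2l (isT : 0 < 2)) -[4]/(2 ^ 2) -expnM -expnS [2 * m]mul2n.
by rewrite h addnA addnn -[X in _ <= X + _]mul2n leq_addr.
Qed.

(** Argument of Erdos: for [n = 2m+1] the primes in [(m+1, n]] divide ['C(n, m)], which is at most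
    [4^m]; an even [n > 2] adds no prime. *)
Lemma primorial_le n : primorial n <= 4 ^ n.
Proof.
elim/ltn_ind: n => n IH.
case: (ltnP n 3) => [|n3].
  case: n {IH} => [|[|[|]]] // _;
    by rewrite /primorial !big_mkcond !big_nat_recr ?big_geq.
have [on|en] := boolP (odd n); last first.
  have -> : primorial n = primorial n.-1.
    rewrite /primorial prednK; last lia.
    rewrite big_mkcond big_nat_recr // -big_mkcond /=.
    case: ifP; rewrite ?muln1 // => /even_prime; lia.
  by apply: leq_trans (IH _ _) _; [lia | apply: leq_pexp2l => //; lia].
have nE : n = n./2.*2.+1 by lia.
set m := n./2 in nE.
rewrite /primorial (@big_cat_nat _ _ _ m.+2) //=; last by lia.
have -> : 4 ^ n = 4 ^ m.+1 * 4 ^ m by rewrite -expnD; congr (_ ^ _); lia.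
apply: leq_mul; first by apply: IH; lia.
apply: leq_trans (bin_odd_le m); apply: dvdn_leq.
  by rewrite bin_gt0; lia.
apply: prod_primes_dvdn => p pp hp.
have := @bin_fact m.*2.+1 m; have -> : m.*2.+1 - m = m.+1 by lia.
move=> /(_ ltac:(lia)) h; have : p %| m.*2.+1`! by rewrite dvdn_fact; lia.
rewrite -h Euclid_dvdM // Euclid_dvdM // => /or3P [//||] /(prime_dvd_fact _ _ pp); lia.
Qed.

(** Legendre's formula for [(2n)!] and [n!], the sum for [n!] being extended by zero terms. *)
Lemma logn_central_bin p n : prime p ->
  logn p 'C(n.*2, n)
  = \sum_(1 <= k < n.*2.+1) (n.*2 %/ p ^ k - (n %/ p ^ k).*2).
Proof.
move=> pp; have p1 := prime_gt1 pp.
have := @bin_fact n.*2 n; have -> : n.*2 - n = n by lia.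
move=> /(_ ltac:(lia)) /(congr1 (logn p)).
rewrite !lognM ?muln_gt0 ?fact_gt0 ?bin_gt0 //; last lia.
have -> : logn p n`! = \sum_(1 <= k < n.*2.+1) n %/ p ^ k.
  rewrite logn_fact // [RHS](@big_cat_nat _ _ _ n.+1) //=; last lia.
  rewrite [X in _ = _ + X]big_nat [X in _ = _ + X]big1 ?addn0 // => k hk.
  by rewrite divn_small //; apply: leq_trans (ltn_expl k p1); lia.
rewrite logn_fact // addnn => h.
have : \sum_(1 <= k < n.*2.+1) (n.*2 %/ p ^ k - (n %/ p ^ k).*2) +
   \sum_(1 <= k < n.*2.+1) (n %/ p ^ k).*2 = \sum_(1 <= k < n.*2.+1) n.*2 %/ p ^ k.
  rewrite -big_split /=; apply: eq_bigr => k _.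
  rewrite subnK // leq_divRL ?expn_gt0 ?prime_gt0 //.
  by have := leq_divM n (p ^ k); rewrite -!mul2n -mulnA; lia.
have -> : \sum_(1 <= k < n.*2.+1) (n %/ p ^ k).*2
   = (\sum_(1 <= k < n.*2.+1) n %/ p ^ k).*2.
  by rewrite -[RHS]mul2n big_distrr /=; apply: eq_bigr => k _; rewrite mul2n.
lia.
Qed.

Lemma divn_double_sub n d : n.*2 %/ d - (n %/ d).*2 <= 1.
Proof.
case: d => [|d]; first by rewrite !divn0.
rewrite leq_subLR -ltnS ltn_divLR //.
have := ltn_ceil n (isT : 0 < d.+1); nia.
Qed.

(** Every summand is 0 or 1, and those with [p^k > 2n] vanish. *)
Lemma logn_central_bin_le p n : prime p -> 0 < n ->
  logn p 'C(n.*2, n) <= trunc_log p n.*2.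
Proof.
move=> pp n0; have p1 := prime_gt1 pp; rewrite logn_central_bin //.
set t := trunc_log _ _.
have tn : t.+1 <= n.*2.+1.
  have := @trunc_logP p n.*2 p1; rewrite -/t; have := ltn_expl t p1; lia.
rewrite (@big_cat_nat _ _ _ t.+1) //= [X in _ + X]big_nat [X in _ + X]big1.
  rewrite addn0; apply: leq_trans (_ : \sum_(1 <= k < t.+1) 1 <= _).
    by apply: leq_sum => k _; apply: divn_double_sub.
  by rewrite sum_nat_const_nat; lia.
move=> k hk; rewrite [n.*2 %/ _]divn_small ?sub0n //.
apply: leq_trans (trunc_log_ltn n.*2 p1) _.
by rewrite leq_exp2l //; lia.
Qed.

(** Induction through [(n+1) C(2n+2, n+1) = 2 (2n+1) C(2n, n)], which [h1] and [h2] combine to. *)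
Lemma central_bin_ge n : 0 < n -> 4 ^ n <= n.*2 * 'C(n.*2, n).
Proof.
elim: n => // -[_ _|n IH _] //; move: (IH isT); set m := n.+1 => h.
have h1 := mul_bin_diag m.*2.+2 m; have h2 := mul_bin_down m.*2.+1 m.
rewrite /= in h1 h2; have h3 : m.*2.+1 - m = m.+1 by lia.
rewrite h3 in h2; rewrite doubleS expnS.
move: h h1 h2; rewrite -muln2; move: (4 ^ m) 'C(_, _) 'C(_, _) 'C(_, _) => *; nia.
Qed.

Lemma prod_if_const a s m :
  \prod_(0 <= p < m) (if 0 < p <= s then a else 1) = a ^ minn m.-1 s.
Proof.
elim: m => [|m IH]; first by rewrite big_geq // min0n.
rewrite big_nat_recr //= {}IH; case: m => [|m]; first by rewrite muln1 min0n.
rewrite succnK; case: ifP => ms; rewrite ?muln1 -?expnSr; congr (_ ^ _); lia.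
Qed.

(* Primes above [sqrt(2n)] divide [C(2n, n)] at most once, and not at all if they
   lie in [(2n/3, n]]. *)
Lemma central_bin_le n s : 0 < n -> n.*2 < s.+1 ^ 2 ->
  'C(n.*2, n) <= n.*2 ^ s * 4 ^ (n.*2 %/ 3)
                 * \prod_(n.+1 <= p < n.*2.+1 | prime p) p.
Proof.
move=> n0 hs; have N0 : 0 < 'C(n.*2, n) by rewrite bin_gt0; lia.
rewrite -{1}(partnT N0) (@widen_partn ('C(n.*2, n) + n.*2)) ?leq_addr //.
rewrite (@big_cat_nat _ _ _ n.*2.+1) //=; last lia.
rewrite [X in _ * X]big_nat_cond [X in _ * X]big1 ?muln1; last first.
  move=> p /andP [hp _]; have [pp|np] := boolP (prime p); last first.
    by rewrite /logn (negbTE np).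
  rewrite logn_central_bin // big_nat big1 // => k hk.
  rewrite divn_small //; have p1 := prime_gt1 pp.
  apply: leq_trans (_ : p ^ 1 <= _); first by rewrite expn1; lia.
  by rewrite leq_exp2l //; lia.
(* Pointwise bounds on the [p]-parts: [2n] for [p <= s], and [p] for larger primes, up to [2n/3] or
   above [n]. All three factors are at least 1, so overlaps do no harm. *)
pose f1 p := if 0 < p <= s then n.*2 else 1.
pose f2 p := if prime p && (p <= n.*2 %/ 3) then p else 1.
pose f3 p := if prime p && (n < p) then p else 1.
apply: leq_trans (_ : \prod_(0 <= p < n.*2.+1) (f1 p * f2 p * f3 p) <= _).
  rewrite big_nat_cond [leqRHS]big_nat_cond; apply: leq_prod => p /andP [hp _].
  have f10 : 0 < f1 p by rewrite /f1; case: ifP; lia.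
  have f20 : 0 < f2 p by rewrite /f2; case: ifP => // /andP [/prime_gt0].
  have f30 : 0 < f3 p by rewrite /f3; case: ifP => // /andP [/prime_gt0].
  have [pp|np] := boolP (prime p); last first.
    by rewrite /logn (negbTE np) expn0 !muln_gt0 f10 f20.
  have p0 := prime_gt0 pp; have p1 := prime_gt1 pp.
  have vt := logn_central_bin_le _ _ pp n0.
  have [ps|sp] := leqP p s.
    apply: leq_trans (_ : n.*2 <= _).
      apply: leq_trans (trunc_logP p1 _); last lia.
      by rewrite leq_exp2l.
    rewrite -mulnA -[leqLHS]muln1 {1}/f1 p0 ps /=.
    by rewrite leq_mul // muln_gt0 f20.
  have p2 : n.*2 < p ^ 2 by apply: leq_trans hs _; rewrite leq_exp2r.
  have v1 : logn p 'C(n.*2, n) <= 1.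
    by apply: leq_trans vt _; rewrite -ltnS -(@ltn_exp2l p) //;
       apply: leq_ltn_trans p2; apply: trunc_logP => //; lia.
  have pv : p ^ logn p 'C(n.*2, n) <= p by rewrite -[leqRHS]expn1 leq_exp2l.
  have [p3|p3] := leqP p (n.*2 %/ 3).
    apply: leq_trans pv _; rewrite /f2 pp p3 /=.
    by rewrite mulnAC leq_pmull // muln_gt0 f10.
  have [pn|pn] := ltnP n p.
    apply: leq_trans pv _; rewrite /f3 pp pn /=.
    by rewrite leq_pmull // muln_gt0 f10.
  rewrite logn_central_bin // big_nat big1 ?expn0; first by rewrite !muln_gt0 f10 f20.
  move=> k /andP [k1 _]; case: k k1 => [//|[_|k _]].
    (* For [2n/3 < p <= n] the quotients of [2n] and [n] by [p] are 2 and 1, so the term [k = 1] is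
       0. *)
    have -> : n.*2 = 2 * p + (n.*2 - 2 * p) by lia.
    rewrite expn1 divnMDl // divn_small ?addn0; last lia.
    have -> : n = 1 * p + (n - p) by lia.
    by rewrite divnMDl // divn_small; lia.
  rewrite divn_small //; apply: leq_trans p2 _.
  by rewrite leq_exp2l.
rewrite !big_split /=; apply: leq_mul; first apply: leq_mul.
- by rewrite /f1 prod_if_const leq_pexp2l; lia.
- apply: leq_trans (primorial_le _); rewrite /primorial.
  rewrite (@big_cat_nat _ _ _ (n.*2 %/ 3).+1) //=; last lia.
  rewrite [X in _ * X]big_nat [X in _ * X]big1 ?muln1; last first.
    by move=> p hp; rewrite /f2; case: ifP => // /andP [_]; lia.
  rewrite [leqRHS]big_mkcond /= big_nat [leqRHS]big_nat; apply: leq_prod => p hp.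
  by rewrite /f2 (_ : p <= n.*2 %/ 3) ?andbT //; lia.
- rewrite (@big_cat_nat _ _ _ n.+1) //=; last lia.
  rewrite big_nat big1 ?mul1n; last first.
    by move=> p hp; rewrite /f3; case: ifP => // /andP [_]; lia.
  rewrite [leqRHS]big_mkcond /= big_nat [leqRHS]big_nat; apply: leq_prod => p hp.
  by rewrite /f3 (_ : n < p) ?andbT //; lia.
Qed.

(** With [X = n %/ (2k)], any [p] in [(X, 2X]] has [k <= n %/ p < 2k], so it divides [i] or one of
    these Stirling numbers. *)
Lemma prod_primes_dvdn_stirling n i k : 0 < k ->
  ((esym_poly (omit n i))`_k)%R \is a Num.int ->
  \prod_((n %/ (2 * k)).+1 <= p < (n %/ (2 * k)).*2.+1 | prime p) p
  %| i * \prod_(k <= m < 2 * k) stirling m k.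
Proof.
move=> k0 hint; apply: prod_primes_dvdn => p pp hp.
have [pi|pi] := boolP (p %| i); first exact: dvdn_mulr.
have p0 := prime_gt0 pp.
have hX := leq_divM n (2 * k).
have hX' := ltn_ceil n (_ : 0 < 2 * k); move: hX'; rewrite muln_gt0 k0 => /(_ isT) hX'.
have km : k <= n %/ p by rewrite leq_divRL //; nia.
have mk : n %/ p < 2 * k by rewrite ltn_divLR //; nia.
have h := prime_dvd_stirling _ _ _ _ pp pi k0 km hint.
apply: dvdn_mull.
rewrite (bigD1_seq (n %/ p)) ?iota_uniq ?mem_index_iota ?km ?mk //=.
exact: dvdn_mulr.
Qed.

Lemma fact_le_expn a m : m < a -> m.+1`! <= a ^ m.
Proof.
elim: m => [|m IH] ma; first by rewrite factS.
by rewrite factS expnS leq_mul // IH // ltnW.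
Qed.

Lemma prod_stirling_le k a : 2 * k <= a ->
  \prod_(k <= m < 2 * k) stirling m k <= a ^ (2 * k ^ 2).
Proof.
case: k => [|k] ka; first by rewrite big_geq.
apply: leq_trans (_ : \prod_(k.+1 <= m < 2 * k.+1) a ^ (2 * k.+1) <= _).
  rewrite big_nat [leqRHS]big_nat; apply: leq_prod => m hm.
  apply: leq_trans (stirling_le _ _) _.
  apply: leq_trans (fact_le_expn a m _) _; first lia.
  by rewrite leq_pexp2l; lia.
by rewrite prod_nat_const_nat -expnM leq_pexp2l; nia.
Qed.

Lemma sqrt_bounds a : exists s, s ^ 2 <= a < s.+1 ^ 2.
Proof.
elim: a => [|a [s hs]]; first by exists 0.
case/andP: hs => hs1 hs2; case: (ltnP a.+1 (s.+1 ^ 2)) => h.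
  by exists s; rewrite h andbT leqW.
by exists s.+1; rewrite h /=; apply: leq_ltn_trans hs2 _; rewrite ltn_exp2r.
Qed.

(** * Numerical estimates for [n >= 2^23] *)

Lemma expn2_poly2 d : 171 * (d + 18) ^ 2 <= 256 * 256 * 2 ^ d.
Proof.
elim: d => [|d IH]; first lia.
have : 171 * (d.+1 + 18) ^ 2 <= 2 * (171 * (d + 18) ^ 2) by nia.
by rewrite (expnS 2 d); lia.
Qed.

(** This gives the final contradiction in [large_not_int]: there [4k <= 9d + 217] makes [320 n]
    smaller than the left-hand side, while the right-hand side is 320 times [2^(d+23)]. *)
Lemma expn2_poly4 d :
  160 * (9 * d + 217) + 288 * ((9 * d + 217) * (d + 24))
  + 36 * ((d + 7) * (9 * d + 217) ^ 3)
  < 320 * (128 * 256 * 256) * 2 ^ d.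
Proof.
elim: d => [|d IH]; first lia.
rewrite (expnS 2 d).
have : (d.+1 + 7) * (9 * d.+1 + 217) ^ 3 <= 2 * ((d + 7) * (9 * d + 217) ^ 3).
  rewrite !expnS expn0; nia.
have : (9 * d.+1 + 217) * (d.+1 + 24) <= 2 * ((9 * d + 217) * (d + 24)) by nia.
by move: IH; move: (_ ^ 3) (_ ^ 3) => *; lia.
Qed.

Lemma expn2_lin d : (256 * 256 + 1) * (9 * d + 217) <= 256 * 256 * 256 * 2 ^ d /\
  9 * d + 217 <= 256 * 2 ^ d.
Proof. by elim: d => [|d [IH1 IH2]]; rewrite ?(expnS 2 d); lia. Qed.

(** The bounds [hs1] and [hl1] multiply to the square of the claim because [81 * 21 <= 10 * 171]. *)
Lemma sqrt_log_bound X s l : 256 * 256 <= X -> s ^ 2 <= X.*2 ->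
  2 ^ l <= X.*2 -> 9 * (l.+1 * s.+1) <= X.
Proof.
move=> hX hs hl.
have hs1 : 10 * s.+1 ^ 2 <= 21 * X.
  case: (leqP (20 * s + 10) X) => [|h]; first by rewrite !expnS expn0 in hs *; lia.
  have : s <= 40 by rewrite !expnS expn0 in hs *; nia.
  nia.
have hl1 : 171 * l.+1 ^ 2 <= X.
  case: (leqP 17 l) => [l17|]; last first.
    rewrite ltnS => l16; have : l.+1 ^ 2 <= 17 ^ 2 by rewrite leq_exp2r.
    by lia.
  have := expn2_poly2 (l - 17); have -> : l - 17 + 18 = l.+1 by lia.
  have : 2 ^ l = 2 ^ 17 * 2 ^ (l - 17) by rewrite -expnD subnKC.
  have -> : 2 ^ 17 = 2 * (256 * 256) by rewrite (_ : 256 = 2 ^ 8) // -expnD -expnS.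
  by lia.
rewrite -leq_sqr !expnMn.
by move: hs1 hl1; move: (l.+1 ^ 2) (s.+1 ^ 2) => a c; nia.
Qed.

(** For [L = d + 23] the bound on [k] reads [4k <= 9L + 10]; larger [k] fall under
    [harmonic_large_lt1]. *)
Lemma large_not_int d n i k : 2 ^ (d + 23) <= n < 2 ^ (d + 24) ->
  0 < i <= n -> 0 < k -> 4 * k <= 9 * d + 217 ->
  ((esym_poly (omit n i))`_k)%R \isn't a Num.int.
Proof.
move=> /andP [hn1 hn2] /andP [i0 hin] k0 hk; apply/negP => hint.
have := prod_primes_dvdn_stirling n i k k0 hint.
have [lin1 lin2] := expn2_lin d.
have e23 : 2 ^ (d + 23) = 128 * 256 * 256 * 2 ^ d.
  by rewrite (_ : 128 = 2 ^ 7) // (_ : 256 = 2 ^ 8) // -!expnD; congr (2 ^ _); lia.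
set X := n %/ (2 * k).
have hX := leq_divM n (2 * k).
have hX' : n < X.+1 * (2 * k) by apply: ltn_ceil; lia.
rewrite -/X in hX.
have X16 : 256 * 256 <= X.
  rewrite leq_divRL; last lia.
  by apply: leq_trans hn1; rewrite e23; lia.
have k2 : 2 * k <= 2 ^ (d + 7).
  by rewrite expnD mulnC (_ : 2 ^ 7 = 128) //; lia.
have P0 : 0 < \prod_(k <= m < 2 * k) stirling m k.
  by rewrite big_nat prodn_cond_gt0 // => m /andP [/stirling_gt0].
move=> /dvdn_leq; rewrite muln_gt0 i0 P0 => /(_ isT) hprod.
have [s /andP [hs1 hs2]] := sqrt_bounds X.*2.
have X0 : 0 < X by lia.
have hbin := central_bin_le X s X0 hs2.
have hge := central_bin_ge X X0.
have /andP [hl1 hl2] := @trunc_log_bounds 2 X.*2 isT ltac:(lia).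
set l := trunc_log 2 X.*2 in hl1 hl2.
have hstir := prod_stirling_le k _ k2.
(* Chains [hge], [hbin] and [hprod], with [2X < 2^(l+1)], [i < 2^(d+24)] and the Stirling product
   bounded by [hstir]. *)
have key : 2 ^ (2 * X) <= 2 ^ (l.+1 * s.+1 + 2 * (X.*2 %/ 3) + (d + 24)
                               + (d + 7) * (2 * k ^ 2)).
  have split a q b c : 2 ^ (a + 2 * q + b + c) = 2 ^ a * (4 ^ q * (2 ^ b * 2 ^ c)).
    rewrite (expnD 2 (a + 2 * q + b)) (expnD 2 (a + 2 * q)) (expnD 2 a) (expnM 2 2).
    by rewrite !mulnA.
  rewrite split (expnM 2 2) (expnM 2 l.+1) (expnM 2 (d + 7)) -[2 ^ 2]/4.
  apply: leq_trans hge _; rewrite [(2 ^ l.+1) ^ _]expnS -mulnA.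
  apply: leq_mul; first exact: ltnW.
  apply: leq_trans hbin _; rewrite -mulnA.
  apply: leq_mul; first by case: (s) => // s'; rewrite leq_exp2r // ltnW.
  apply: leq_mul => //; apply: leq_trans hprod _.
  by apply: leq_mul => //; apply: leq_trans hin (ltnW hn2).
rewrite leq_exp2l // in key.
have hsq := sqrt_log_bound X s l X16 hs1 hl1.
have h3 := leq_divM X.*2 3.
have p4 := expn2_poly4 d.
(* As [(l+1)(s+1) <= X/9], the left side keeps [2X - 4X/3 - X/9 = 5X/9]. *)
have key2 : 5 * X <= 9 * (d + 24) + 18 * ((d + 7) * k ^ 2) by lia.
(* The factor [2k] leads back from [X] to [n] through [hX']. *)
have key3 : 5 * (X * (2 * k)) <= 18 * ((d + 24) * k) + 36 * ((d + 7) * k ^ 3).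
  have := leq_mul key2 (leqnn (2 * k)); rewrite (expnS k 2).
  by move: (k ^ 2) => q; lia.
have k3 : 64 * k ^ 3 <= (9 * d + 217) ^ 3.
  by rewrite -[64]/(4 ^ 3) -expnMn leq_exp2r.
have hkc : 36 * ((d + 7) * (64 * k ^ 3)) <= 36 * ((d + 7) * (9 * d + 217) ^ 3).
  by rewrite !leq_mul2l k3 !orbT.
have hkd : 4 * ((d + 24) * k) <= (9 * d + 217) * (d + 24).
  by rewrite mulnCA mulnC leq_mul2r hk orbT.
move: hn1 hX' key3 p4; rewrite e23 mulSn.
move=> {e23 hl1 hl2 hs1 hs2 hsq lin1 lin2 hin hn2 key key2}; move: hkc.
have -> : 36 * ((d + 7) * (64 * k ^ 3)) = 64 * (36 * ((d + 7) * k ^ 3)) by lia.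
move: (9 * d + 217) ((d + 7) * (_ ^ 3)) ((d + 7) * k ^ 3) hk hkd => c Q K hk hkd.
lia.
Qed.

Local Notation integral n i k := (((esym_poly (omit n i))`_k)%R \is a Num.int).

(** * Certified computation for [n < 2^23] *)

Lemma to_nat_div a b : N.to_nat (a / b) = N.to_nat a %/ N.to_nat b.
Proof.
have [->|b0] := N.eq_dec b 0; first by case: a.
have h := N.div_mod' a b; have r := N.mod_lt a b b0.
have -> : N.to_nat a = N.to_nat (a / b) * N.to_nat b + N.to_nat (a mod b) by lia.
by rewrite divnMDl ?divn_small ?addn0 //; lia.
Qed.

Lemma dvd_to_nat p a : (a mod p =? 0)%num = (N.to_nat p %| N.to_nat a).
Proof.
have [->|p0] := N.eq_dec p 0; first by rewrite N.mod_0_r dvd0n; lia.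
have h := N.div_mod' a p; have r := N.mod_lt a p p0.
have -> : N.to_nat a = N.to_nat (a / p) * N.to_nat p + N.to_nat (a mod p) by lia.
rewrite dvdn_addr ?dvdn_mull //.
have [e|ne] := N.eq_dec (a mod p) 0; first by rewrite e dvdn0.
move: (a mod p)%num ne r {h} => x ne r.
by rewrite gtnNdvd; lia.
Qed.

(** * Primality by trial division *)

Fixpoint trial_division (fuel : nat) (p d : N) : bool :=
  if (p <? d * d)%num then true else
  if fuel is fuel'.+1 then
    ~~ (p mod d =? 0)%num && trial_division fuel' p (d + 1)
  else false.

Lemma trial_divisionP fuel p d : (0 < d)%num -> trial_division fuel p d ->
  forall q, N.to_nat d <= q -> q ^ 2 <= N.to_nat p -> ~~ (q %| N.to_nat p).
Proof.
elim: fuel d => [|fuel IH] d d0 /=; case: ifP => hd;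
  rewrite ?expnS ?expn0 => // h q dq qp.
- by move: qp; rewrite !expnS expn0; nia.
- by move: qp; rewrite !expnS expn0; nia.
case/andP: h; rewrite dvd_to_nat => hdiv h.
have [<-//|ne] := eqVneq (N.to_nat d) q.
by apply: (IH (d + 1)%num) => //; lia.
Qed.

Lemma trial_division_prime fuel p : (1 < p)%num -> trial_division fuel p 2 ->
  prime (N.to_nat p).
Proof.
move=> p1 h; have p0 : 0 < N.to_nat p by lia.
apply: ltn_pdiv2_prime => //; rewrite ltnNge; apply/negP => hq.
have d0 : (0 < 2)%num by lia.
have := trial_divisionP _ _ _ d0 h (pdiv (N.to_nat p)) _ hq.
rewrite pdiv_dvd => H; suff: ~~ true by [].
by apply/H/prime_gt1/pdiv_prime; lia.
Qed.

(* [next_column k 0 [stirling (k-1) (k-1); stirling k (k-1); ...]] is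
   [stirling k k; stirling (k+1) k; ...]. *)
Fixpoint next_column (m prev : N) (col : seq N) : seq N :=
  if col is a :: col' then
    let b := (m * prev + a)%num in b :: next_column (m + 1) b col'
  else [::].

Definition column_ok (k : nat) (col : seq N) :=
  forall j, j < size col -> N.to_nat (nth 0%num col j) = stirling (k + j) k.

Lemma next_column_ok k col : column_ok k col ->
  column_ok k.+1 (next_column (N.of_nat k.+1) 0 col).
Proof.
(* Stated from an arbitrary offset [j0], with [prev] the entry just computed, so that the induction
   can move along the column. *)
have main m prev c j0 : (forall j, j < size c ->
    N.to_nat (nth 0%num c j) = stirling (k + j0 + j) k) ->
  N.to_nat prev = stirling (k + j0) k.+1 -> N.to_nat m = (k + j0).+1 ->
  forall j, j < size (next_column m prev c) ->
    N.to_nat (nth 0%num (next_column m prev c) j) = stirling (k + j0 + j).+1 k.+1.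
  elim: c m prev j0 => [//|a c IH] m prev j0 hc hp hm.
  have hb : N.to_nat (m * prev + a) = stirling (k + j0).+1 k.+1.
    have /= := hc 0 isT; rewrite addn0 => ha.
    by rewrite /= -hp -ha; lia.
  rewrite [next_column _ _ _]/= => -[_|j hj]; first by rewrite addn0.
  have -> : k + j0 + j.+1 = k + j0.+1 + j by lia.
  apply: IH => // [j' hj'||]; rewrite ?addnS //; last lia.
  by rewrite addSn -addnS; apply: (hc j'.+1).
move=> h j hj; have := main (N.of_nat k.+1) 0%num col 0 _ _ _ j hj.
rewrite addn0 addSn; apply => //; last by rewrite Nat2N.id.
(* The initial 0 is [stirling k k.+1]. *)
by rewrite stirling_small.
Qed.

(* Accumulates in [g] primes which, for every [n'] in [[n, e)], must divide any
   [i] with [T n' i k] integral; [ps] is expected in decreasing order. Off the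
   end of [col] the default [0] makes a prime unusable, which is sound. *)
Fixpoint collect (k : N) (col ps : seq N) (n g e : N) : N * N :=
  if (n <? g)%num then (g, e) else
  if ps is p :: ps' then
    if (n <? k * p)%num then collect k col ps' n g e else
    let m := (n / p)%num in
    if (k + N.of_nat (size col) <=? m)%num then (g, e) else
    if (nth 0 col (N.to_nat (m - k)) mod p =? 0)%num || (g mod p =? 0)%num
    then collect k col ps' n g e
    else collect k col ps' n (g * p) (N.min e ((m + 1) * p))
  else (g, e).

Definition prime_list (ps : seq N) := all (fun p => prime (N.to_nat p)) ps.

(** As long as [n' < (m+1) p], the quotient [n' %/ p] remains [m], so one Stirling number decides
    for all such [n']. An accepted prime is coprime to [g], so their product divides [i] once both
    do. *)
Lemma collectP (k : N) col ps n g e : (0 < k)%num ->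
  column_ok (N.to_nat k) col -> prime_list ps ->
  let: (g', e') := collect k col ps n g e in
  (e' <= e)%num /\ forall n' i, N.to_nat n <= n' < N.to_nat e' ->
    integral n' i (N.to_nat k) -> N.to_nat g %| i -> N.to_nat g' %| i.
Proof.
move=> k0 hcol; elim: ps g e => [|p ps IH] g e /=.
  by case: ifP => _ _; split; lia.
case: ifP => [_ _|_ /andP [pp hps]]; first by split; lia.
case: ifP => [_|kp]; first exact: IH.
case: ifP => [_|km]; first by split; lia.
case: ifP => [_|/norP [hm hg]]; first exact: IH.
have p0 := prime_gt0 pp.
set m := (n / p)%num in km hm *.
have hmE : N.to_nat m = N.to_nat n %/ N.to_nat p by rewrite to_nat_div.
have := IH (g * p)%num (N.min e ((m + 1) * p)) hps.
case: (collect _ _ _ _ _ _) => g' e' [he H]; split; first by lia.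
move=> n' i hn' hint gi; apply: (H n' i) => //.
have k1 : N.to_nat k <= N.to_nat m by rewrite hmE leq_divRL //; lia.
have mE : n' %/ N.to_nat p = N.to_nat m.
  apply/eqP; rewrite eqn_leq -ltnS ltn_divLR // leq_divRL //.
  have := leq_divM (N.to_nat n) (N.to_nat p); rewrite -hmE; nia.
rewrite dvd_to_nat in hg; rewrite dvd_to_nat hcol in hm; last lia.
have -> : N.to_nat (g * p) = N.to_nat g * N.to_nat p by lia.
rewrite Gauss_dvd; last by rewrite coprime_sym prime_coprime.
rewrite gi /=; apply/negPn/negP => pi; move: hm.
have -> : N.to_nat k + N.to_nat (m - k) = n' %/ N.to_nat p by rewrite mE; lia.
by rewrite (prime_dvd_stirling n' i) // ?mE //; lia.
Qed.

Lemma collect_bounds (k : N) col ps n g e : prime_list ps ->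
  (0 < g)%num -> (n < e)%num ->
  (0 < (collect k col ps n g e).1)%num /\ (n < (collect k col ps n g e).2)%num.
Proof.
elim: ps g e => [|p ps IH] g e /=; first by case: ifP.
case: ifP => [//|_ /andP [pp hps]].
case: ifP => [_|kp]; first exact: IH.
case: ifP => [//|km]; case: ifP => [_|_]; first exact: IH.
have p0 := prime_gt0 pp; move=> g0 ne; apply: IH => //; first lia.
have := ltn_ceil (N.to_nat n) p0; rewrite -to_nat_div; nia.
Qed.

(** Stacking primes from an increasing list yields the decreasing order that [collect] expects. *)
Fixpoint push (k cur : N) (st rest : seq N) : seq N * seq N :=
  if rest is p :: rest' then
    if (k * p <=? cur)%num then push k cur (p :: st) rest' else (st, rest)
  else (st, [::]).

Lemma push_prime k cur st rest : prime_list st -> prime_list rest ->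
  prime_list (push k cur st rest).1 /\ prime_list (push k cur st rest).2.
Proof.
elim: rest st => [//|p rest IH] st hst /= /andP [hp hr].
by case: ifP => _ /=; [apply: IH|rewrite hp hr]; rewrite //= hp.
Qed.

(** For [n < e] an index [i] with integral sum is a multiple of [g], which is impossible for
    [i <= n < g]. So everything below [N.min g e] is settled and the sweep resumes there. *)
Fixpoint sweep (fuel : nat) (k : N) (col : seq N) (hi cur : N) (st rest : seq N)
  : bool :=
  if (hi <=? cur)%num then true else
  if fuel is fuel'.+1 then
    let: (st', rest') := push k cur st rest in
    let: (g, e) := collect k col st' cur 1 hi in
    sweep fuel' k col hi (N.min g e) st' rest'
  else false.

Lemma sweepP fuel k col hi cur st rest : (0 < k)%num ->
  column_ok (N.to_nat k) col -> prime_list st -> prime_list rest ->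
  sweep fuel k col hi cur st rest ->
  forall n i, N.to_nat cur <= n < N.to_nat hi -> 0 < i <= n ->
  ~~ (integral n i (N.to_nat k)).
Proof.
move=> k0 hcol; elim: fuel cur st rest => [|fuel IH] cur st rest hst hrest /=.
  by case: ifP => // h _ n i; lia.
case: ifP => [h _ n i|_]; first lia.
have := push_prime k cur st rest hst hrest.
case: (push _ _ _ _) => st' rest' /= [hst' hrest'].
have := collectP k col st' cur 1 hi k0 hcol hst'.
case: (collect _ _ _ _ _ _) => g e [_ H] h n i hn hi0.
have [hlt|hge] := ltnP n (N.to_nat (N.min g e)); last first.
  by apply: (IH _ _ _ hst' hrest' h) => //; rewrite hge; case/andP: hn.
apply/negP => hint.
have /dvdn_leq : N.to_nat g %| i by apply: (H n) => //; lia.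
lia.
Qed.

(** * Fixed-point enclosures in units of [2^-24] *)

Definition scale : N := 16777216.
(* Otherwise tactics may expand [N.to_nat scale] in unary. *)
Opaque scale.

Definition encloses (v : N * N) (x : rat) : Prop :=
  ((N.to_nat v.1)%:R <= (N.to_nat scale)%:R * x <= (N.to_nat v.2)%:R)%R.

Lemma divn_bounds a n : 0 < n ->
  (((a %/ n)%N)%:R <= a%:R / n%:R :> rat)%R /\
  (a%:R / n%:R <= ((a %/ n).+1)%:R :> rat)%R.
Proof.
move=> n0; have n0' : (0 < n%:R :> rat)%R by rewrite ltr0n.
rewrite ler_pdivlMr // ler_pdivrMr // -!natrM !ler_nat leq_divM; split=> //.
by apply/ltnW/ltn_ceil.
Qed.

(** Division rounds down, hence the [+ 1] in the upper bound. *)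
Lemma encloses_add v w x y n : (0 < n)%num -> encloses v x -> encloses w y ->
  encloses (v.1 + w.1 / n, v.2 + w.2 / n + 1)%num (x + (N.to_nat n)%:R^-1 * y)%R.
Proof.
rewrite /encloses; move: ((N.to_nat scale)%:R)%R => D.
move=> n0 /andP [v1 v2] /andP [w1 w2].
have n0' : 0 < N.to_nat n by lia.
have [a1 _] := divn_bounds (N.to_nat w.1) _ n0'.
have [_ b2] := divn_bounds (N.to_nat w.2) _ n0'.
have -> : N.to_nat (v.1 + w.1 / n) = N.to_nat v.1 + N.to_nat w.1 %/ N.to_nat n.
  by rewrite -to_nat_div; lia.
have -> : N.to_nat (v.2 + w.2 / n + 1) = N.to_nat v.2 + (N.to_nat w.2 %/ N.to_nat n).+1.
  by rewrite -to_nat_div; lia.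
rewrite !natrD.
rewrite /=; have i0 : (0 <= (N.to_nat n)%:R^-1 :> rat)%R by rewrite invr_ge0 ler0n.
have c1 := ler_wpM2r i0 w1; have c2 := ler_wpM2r i0 w2.
by apply/andP; split; lra.
Qed.

(** Nonnegativity of the difference makes truncated subtraction safe: a lower bound cut off at 0
    stays valid, and the upper one is never cut off. *)
Lemma encloses_sub v w x y i : (0 < i)%num -> encloses v x -> encloses w y ->
  (0 <= x - (N.to_nat i)%:R^-1 * y)%R ->
  encloses (v.1 - (w.2 / i + 1), v.2 - w.1 / i)%num (x - (N.to_nat i)%:R^-1 * y)%R.
Proof.
rewrite /encloses.
have : (0 <= (N.to_nat scale)%:R :> rat)%R by rewrite ler0n.
move: ((N.to_nat scale)%:R)%R => D hD i0 /andP [v1 v2] /andP [w1 w2] hxy.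
have i0' : 0 < N.to_nat i by lia.
have [a1 _] := divn_bounds (N.to_nat w.1) _ i0'.
have [_ b2] := divn_bounds (N.to_nat w.2) _ i0'.
have h0 := mulr_ge0 hD hxy.
have -> : N.to_nat (v.1 - (w.2 / i + 1)) = N.to_nat v.1 - (N.to_nat w.2 %/ N.to_nat i).+1.
  by rewrite -to_nat_div; lia.
have -> : N.to_nat (v.2 - w.1 / i) = N.to_nat v.2 - N.to_nat w.1 %/ N.to_nat i.
  by rewrite -to_nat_div; lia.
have j0 : (0 <= (N.to_nat i)%:R^-1 :> rat)%R by rewrite invr_ge0 ler0n.
have c1 := ler_wpM2r j0 w1; have c2 := ler_wpM2r j0 w2.
have s1 p q : q <= p -> ((p - q)%N%:R = p%:R - q%:R :> rat)%R by exact: natrB.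
apply/andP; split.
  have [h|h] := leqP (N.to_nat w.2 %/ N.to_nat i).+1 (N.to_nat v.1).
    by rewrite s1 //; lra.
  by rewrite (eqP (ltnW h : _ - _ == 0)).
rewrite s1; first lra.
by rewrite -(@ler_nat rat); lra.
Qed.

(** Position [j] is for [e_(j+1)]; the constant [e_0 = 1], exactly [(scale, scale)], is supplied
    separately. *)
Definition row_ok (n : nat) (row : seq (N * N)) :=
  forall j, j < size row ->
    encloses (nth (scale, scale) row j) ((esym_poly (iota 1 n))`_j.+1)%R.

Fixpoint next_row (n : N) (prev : N * N) (row : seq (N * N)) : seq (N * N) :=
  if row is x :: row' then
    (x.1 + prev.1 / n, x.2 + prev.2 / n + 1)%num :: next_row n x row'
  else [::].

Lemma encloses_one : encloses (scale, scale) 1%R.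
Proof. by rewrite /encloses mulr1 lexx. Qed.

Lemma size_next_row n prev row : size (next_row n prev row) = size row.
Proof. by elim: row prev => //= x row IH prev; rewrite IH. Qed.

Lemma nth_next_row n prev row j : j < size row ->
  nth (scale, scale) (next_row n prev row) j =
  let x := nth (scale, scale) row j in
  let w := nth (scale, scale) (prev :: row) j in
  (x.1 + w.1 / n, x.2 + w.2 / n + 1)%num.
Proof. by elim: row prev j => //= x row IH prev [|j] //= hj; rewrite IH. Qed.

Lemma next_row_ok n row : row_ok n row ->
  row_ok n.+1 (next_row (N.of_nat n.+1) (scale, scale) row).
Proof.
move=> h j; rewrite size_next_row => hj; rewrite nth_next_row //= harmonicS.
have hw : encloses (nth (scale, scale) ((scale, scale) :: row) j)
                   ((esym_poly (iota 1 n))`_j)%R.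
  case: j hj => [_|j hj] /=; last by apply: h; apply: ltnW.
  rewrite coef0_esym; exact: encloses_one.
have n0 : (0 < N.of_nat n.+1)%num by lia.
by have := encloses_add _ _ _ _ _ n0 (h j hj) hw; rewrite Nat2N.id.
Qed.

(* The functions [T_k] with [1/i] left out are recovered from the full ones [H_k]
   by [T_k = H_k - T_(k-1) / i]; the test is that the enclosure
   of the last one contains no integer. *)
Fixpoint omit_nonint (i : N) (v : N * N) (row : seq (N * N)) (k : nat) : bool :=
  if row is x :: row' then
    let v' := (x.1 - (v.2 / i + 1), x.2 - v.1 / i)%num in
    if k is k'.+1 then omit_nonint i v' row' k'
    else (v'.2 / scale * scale <? v'.1)%num
  else false.

(** [v.2 / scale * scale] is the largest multiple of [scale] up to [v.2]; if it is below [v.1], the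
    interval contains none. *)
Lemma encloses_not_int v x : (0 < scale)%num -> encloses v x ->
  (v.2 / scale * scale <? v.1)%num -> x \isn't a Num.int.
Proof.
rewrite /encloses => D0 /andP [h1 h2] /N.ltb_lt h; apply/negP => /intrP [z hz].
have d0 : 0 < N.to_nat scale by lia.
have : N.to_nat v.2 %/ N.to_nat scale * N.to_nat scale < N.to_nat v.1.
  by rewrite -to_nat_div; lia.
move: h1 h2 d0; rewrite {x}hz.
move: (N.to_nat scale) (N.to_nat v.1) (N.to_nat v.2) => D a b h1 h2 d0 hab.
have D0' : (0 < D%:R :> rat)%R by rewrite ltr0n.
have z0 : (0 <= z)%R.
  rewrite -(ler0z rat) -(pmulr_rge0 _ D0'); apply: le_trans h1; exact: ler0n.
case: z z0 h1 h2 => // z _; rewrite -!natrM !ler_nat => h1 h2.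
have : z <= b %/ D by rewrite leq_divRL // mulnC.
nia.
Qed.

Lemma omit_nonintP n (i : N) v row t k : (0 < scale)%num ->
  0 < N.to_nat i <= n ->
  encloses v ((esym_poly (omit n (N.to_nat i)))`_t)%R ->
  (forall j, j < size row ->
     encloses (nth (scale, scale) row j) ((esym_poly (iota 1 n))`_(t + j).+1)%R) ->
  omit_nonint i v row k -> ~~ integral n (N.to_nat i) (t + k).+1.
Proof.
move=> D0 hi; elim: row v t k => [//|x row IH] v t k hv hrow /=.
set v' := (_, _).
have hv' : encloses v' ((esym_poly (omit n (N.to_nat i)))`_t.+1)%R.
  have hx := hrow 0 isT; rewrite addn0 /= in hx.
  have e : ((esym_poly (omit n (N.to_nat i)))`_t.+1 = (esym_poly (iota 1 n))`_t.+1
     - (N.to_nat i)%:R^-1 * (esym_poly (omit n (N.to_nat i)))`_t)%R.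
    by rewrite (omit_recr _ _ _ hi) addrK.
  rewrite e; apply: encloses_sub => //; first by lia.
  by rewrite -e esym_ge0.
case: k => [|k]; first by rewrite addn0; apply: (encloses_not_int _ _ D0 hv').
rewrite -addSnnS; apply: IH hv' _ => j hj.
by rewrite addSnnS; apply: (hrow j.+1).
Qed.

Definition exceptional (n i k : N) : bool :=
  ((n =? 2) && (i =? 2) && (k =? 1) || (n =? 4) && (i =? 4) && (k =? 2))%num.

Fixpoint check_multiples (fuel : nat) (n k g i : N) (row : seq (N * N)) : bool :=
  if (n <? i)%num then true else
  if fuel is fuel'.+1 then
    (exceptional n i k || omit_nonint i (scale, scale) row (N.to_nat k).-1)
    && check_multiples fuel' n k g (i + g) row
  else false.

Lemma check_multiplesP fuel n k g i row : (0 < scale)%num -> (0 < k)%num ->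
  (0 < g)%num -> (0 < i)%num ->
  N.to_nat g %| N.to_nat i -> row_ok (N.to_nat n) row ->
  check_multiples fuel n k g i row ->
  forall j, (i <= j <= n)%num -> N.to_nat g %| N.to_nat j ->
  exceptional n j k \/ ~~ integral (N.to_nat n) (N.to_nat j) (N.to_nat k).
Proof.
move=> D0 k0 g0; elim: fuel i => [|fuel IH] i i0 gi hrow /=; case: ifP => hni.
- by move=> _ j; lia.
- by [].
- by move=> _ j; lia.
case/andP => hi hrest j hj gj.
have [e|ne] := N.eq_dec i j.
  rewrite -e; case/orP: hi => hi; [by left|right].
  have in0 : 0 < N.to_nat i <= N.to_nat n by lia.
  have := omit_nonintP (N.to_nat n) i _ row 0 _ D0 in0 _ hrow hi.
  rewrite add0n prednK; last lia.
  by apply; rewrite coef0_esym; apply: encloses_one.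
apply: (IH (i + g)%num) => //; try lia.
  have -> : N.to_nat (i + g) = N.to_nat i + N.to_nat g by lia.
  by rewrite dvdn_add.
(* No multiple of [g] lies strictly between [i] and [i + g]. *)
have : N.to_nat g <= N.to_nat (j - i).
  apply: dvdn_leq; first lia.
  have -> : N.to_nat (j - i) = N.to_nat j - N.to_nat i by lia.
  exact: dvdn_sub.
by lia.
Qed.

(** The end [n + 1] makes [collect] treat [n] alone; the indices [i] left open are then the
    multiples of [g]. *)
Definition check_entry (fuel : nat) (small : seq N) (n k : N)
  (row : seq (N * N)) (col : seq N) : bool :=
  if ((nth (scale, scale) row (N.to_nat k).-1).2 <? scale)%num then true else
  let g := (collect k col small n 1 (n + 1)).1 in
  if (n <? g)%num then true else check_multiples fuel n k g g row.

Lemma check_entryP fuel small n k row col : (0 < scale)%num -> (0 < k)%num ->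
  (k < n)%num -> prime_list small -> column_ok (N.to_nat k) col ->
  row_ok (N.to_nat n) row -> check_entry fuel small n k row col ->
  forall i, (0 < i <= n)%num ->
  exceptional n i k \/ ~~ integral (N.to_nat n) (N.to_nat i) (N.to_nat k).
Proof.
move=> D0 k0 kn hsmall hcol hrow /orP [hlt|h] i hi.
  right; apply: omit_not_int; try lia.
  (* Past the end of the row the default would turn the test into [scale < scale]. *)
  have hk : (N.to_nat k).-1 < size row.
    rewrite ltnNge; apply/negP => hs; move: hlt => /N.ltb_lt.
    by rewrite nth_default // => /N.lt_irrefl.
  have := hrow _ hk; rewrite /encloses prednK; last lia.
  have d0 : (0 < (N.to_nat scale)%:R :> rat)%R by rewrite ltr0n; lia.
  case/andP => _ h2; rewrite -(ltr_pM2l d0) mulr1.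
  by apply: le_lt_trans h2 _; rewrite ltr_nat; lia.
have := collectP k col small n 1 (n + 1)%num k0 hcol hsmall.
have := collect_bounds k col small n 1 (n + 1)%num hsmall.
move: h; case: (collect k col small n 1 (n + 1)) => g e /= h hge [_ H].
have [//|g0 ne] := hge _ ltac:(lia).
have [hint|] := boolP (integral (N.to_nat n) (N.to_nat i) (N.to_nat k)); last by right.
have gi : N.to_nat g %| N.to_nat i by apply: (H (N.to_nat n)) => //; lia.
case/orP: h => [hng|h].
  have := dvdn_leq _ gi; lia.
have := check_multiplesP _ _ _ _ _ _ D0 k0 _ _ (dvdnn _) hrow h i _ gi.
have : N.to_nat g <= N.to_nat i by apply: dvdn_leq => //; lia.
by rewrite hint => gi'; case => //; try lia; left.
Qed.

(** The constant coefficient of [(X+1)...(X+t)] is [t!]. *)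
Fixpoint fact_column (m b : N) (len : nat) : seq N :=
  if len is len'.+1 then b :: fact_column (m + 1) (m * b) len' else [::].

Lemma fact_column_ok len : column_ok 0 (fact_column 1 1 len).
Proof.
have main m b t l : N.to_nat b = stirling t 0 -> N.to_nat m = t.+1 ->
    forall j, j < size (fact_column m b l) ->
    N.to_nat (nth 0%num (fact_column m b l) j) = stirling (t + j) 0.
  elim: l m b t => [//|l IH] m b t hb hm [_|j hj] /=; first by rewrite addn0.
  rewrite -addSnnS; apply: IH => //; last lia.
  by rewrite /= -hb -hm; lia.
exact: main.
Qed.

Fixpoint columns_from (k : N) (col : seq N) (count : nat) : seq (seq N) :=
  if count is count'.+1 then
    let col' := next_column k 0 col in col' :: columns_from (k + 1) col' count'
  else [::].

Definition columns_ok (k : nat) (cols : seq (seq N)) :=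
  forall j, j < size cols -> column_ok (k + j) (nth [::] cols j).

Lemma columns_ok_behead k col cols :
  columns_ok k (col :: cols) -> columns_ok k.+1 cols.
Proof. by move=> h j hj; rewrite addSnnS; apply: (h j.+1). Qed.

Lemma columns_from_ok k col count : column_ok k col ->
  columns_ok k.+1 (columns_from (N.of_nat k.+1) col count).
Proof.
elim: count k col => [//|c IH] k col h.
have h' := next_column_ok k col h.
rewrite /columns_from -/columns_from.
have -> : (N.of_nat k.+1 + 1 = N.of_nat k.+2)%num by lia.
case=> [_|j hj]; first by rewrite addn0.
by rewrite -addSnnS; apply: IH.
Qed.

Definition columns (count len : nat) : seq (seq N) :=
  columns_from 1 (fact_column 1 1 len) count.

Lemma columns_correct count len : columns_ok 1 (columns count len).
Proof. exact: columns_from_ok (fact_column_ok len). Qed.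

Lemma size_columns count len : size (columns count len) = count.
Proof.
have h k col : size (columns_from k col count) = count.
  by elim: count k col => //= c IH k col; rewrite IH.
exact: h.
Qed.

Fixpoint check_row (fuel : nat) (small : seq N) (n k : N) (row : seq (N * N))
  (cols : seq (seq N)) : bool :=
  if cols is col :: cols' then
    if (n <=? k)%num then true else
    check_entry fuel small n k row col && check_row fuel small n (k + 1) row cols'
  else true.

Lemma check_rowP fuel small n k row cols : (0 < scale)%num -> (0 < k)%num ->
  prime_list small -> columns_ok (N.to_nat k) cols ->
  row_ok (N.to_nat n) row -> check_row fuel small n k row cols ->
  forall i j, (0 < i <= n)%num -> (k <= j < n)%num ->
  N.to_nat j < N.to_nat k + size cols ->
  exceptional n i j \/ ~~ integral (N.to_nat n) (N.to_nat i) (N.to_nat j).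
Proof.
move=> D0 k0 hsmall; elim: cols k k0 => [|col cols IH] k k0 hcols hrow /=.
  by move=> _ i j; lia.
case: ifP => [hnk _ i j|hnk]; first lia.
case/andP => hk hrest i j hi hj hjs.
have [e|ne] := N.eq_dec k j.
  rewrite -e; apply: (check_entryP fuel small n k row col) => //; first lia.
  by have := hcols 0 isT; rewrite addn0.
apply: (IH (k + 1)%num) => //; try lia.
have -> : N.to_nat (k + 1) = (N.to_nat k).+1 by lia.
exact: columns_ok_behead hcols.
Qed.

(** The last test bounds the final harmonic number by [152/20], the starting value for
    [harmonic_pow2]. *)
Fixpoint check_rows (fuel : nat) (small : seq N) (n : N) (row : seq (N * N))
  (cols : seq (seq N)) : bool :=
  if fuel is fuel'.+1 then
    let row' := next_row (n + 1) (scale, scale) row in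
    check_row (N.to_nat n).+1 small (n + 1) 1 row' cols
    && check_rows fuel' small (n + 1) row' cols
  else if row is x :: _ then (20 * x.2 <=? 152 * scale)%num else false.

Lemma check_rowsP fuel small n row cols : (0 < scale)%num ->
  prime_list small -> columns_ok 1 cols -> row_ok n row ->
  check_rows fuel small (N.of_nat n) row cols ->
  (forall m i k, n < m <= n + fuel -> 0 < i <= m -> 0 < k < m -> k <= size cols ->
   exceptional (N.of_nat m) (N.of_nat i) (N.of_nat k) \/ ~~ integral m i k)
  /\ ((esym_poly (iota 1 (n + fuel)))`_1 <= 152%:R / 20%:R)%R.
Proof.
move=> D0 hsmall hcols; elim: fuel n row => [|fuel IH] n row hrow.
  rewrite addn0 => H; split; first by move=> m i k; lia.
  case: row hrow H => [|x row] hrow H; first case: (notF H).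
  have /N.leb_le hx : (20 * x.2 <=? 152 * scale)%num := H.
  have := hrow 0 isT; rewrite /encloses => /andP [_ h].
  have d0 : (0 < (N.to_nat scale)%:R :> rat)%R by rewrite ltr0n; lia.
  rewrite -(ler_pM2l d0); apply: le_trans h _.
  have : 20 * N.to_nat x.2 <= 152 * N.to_nat scale.
    by move: hx {H D0 d0 hrow}; move: (x.2) scale => a b; lia.
  move: (N.to_nat x.2) (N.to_nat scale) => a b {H D0 d0 hrow hx} hab.
  rewrite mulrA ler_pdivlMr ?ltr0n // -!natrM ler_nat; lia.
rewrite /check_rows -/check_rows.
have -> : (N.of_nat n + 1 = N.of_nat n.+1)%num by lia.
have hrow' := next_row_ok n row hrow.
case/andP => hr hrest; have [H1 H2] := IH n.+1 _ hrow' hrest.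
rewrite -addSnnS; split=> // m i k hm hi hk hks.
have [e|ne] := eqVneq m n.+1; last by apply: H1 => //; lia.
rewrite e in hi hk *.
have k0 : (0 < 1)%num by lia.
have hrow2 : row_ok (N.to_nat (N.of_nat n.+1))
    (next_row (N.of_nat n.+1) (scale, scale) row) by rewrite Nat2N.id.
have := check_rowP _ small (N.of_nat n.+1) 1 _ cols D0 k0 hsmall hcols hrow2 hr
  (N.of_nat i) (N.of_nat k).
by rewrite !Nat2N.id; apply; lia.
Qed.

(** * Sweeps for [2^10 <= n < 2^23] *)

(** For [n] from [2^10] up to this power of 2, [k] is so large that [harmonic_large_lt1] applies. *)
Fixpoint sweep_start (fuel : nat) (k L : N) : N :=
  if fuel is fuel'.+1 then
    if (4 * k <=? 9 * L + 10)%num then (2 ^ L)%num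
    else sweep_start fuel' k (L + 1)
  else (2 ^ L)%num.

Fixpoint check_sweeps (fuel : nat) (primes : seq N) (hi k : N)
  (cols : seq (seq N)) : bool :=
  if cols is col :: cols' then
    sweep fuel k col hi (sweep_start 20 k 10) [::] primes
    && check_sweeps fuel primes hi (k + 1) cols'
  else true.

Lemma to_nat_pow2 M : N.to_nat (2 ^ N.of_nat M) = 2 ^ M.
Proof.
elim: M => // M IH; rewrite Nat2N.inj_succ N.pow_succ_r' expnS -IH; lia.
Qed.

Lemma sweep_start_le fuel k L M : (L + N.of_nat fuel <= M)%num \/
  (L <= M /\ 4 * k <= 9 * M + 10)%num ->
  (sweep_start fuel k L <= 2 ^ M)%num.
Proof.
elim: fuel L => [|fuel IH] L h; rewrite /sweep_start -/sweep_start.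
  by apply: N.pow_le_mono_r => //; lia.
case: ifP => [hk|/N.leb_gt hk]; first by apply: N.pow_le_mono_r => //; lia.
rewrite Nat2N.inj_succ in h.
apply: IH; case: h => [h|[h1 h2]]; [left; lia|right; split; lia].
Qed.

Lemma check_sweepsP fuel primes hi k cols : (0 < k)%num -> prime_list primes ->
  columns_ok (N.to_nat k) cols -> check_sweeps fuel primes hi k cols ->
  forall n i j L, 10 <= L -> 2 ^ L <= n < N.to_nat hi -> 4 * j <= 9 * L + 10 ->
  0 < i <= n -> N.to_nat k <= j < N.to_nat k + size cols -> ~~ integral n i j.
Proof.
move=> k0 hp; elim: cols k k0 => [|col cols IH] k k0 hcols /=.
  by move=> _ n i j L; lia.
case/andP => hs hrest n i j L hL hn hj hin hk.
have [e|ne] := eqVneq j (N.to_nat k).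
  rewrite e; apply: (sweepP fuel k col hi _ [::] primes k0 _ isT hp hs) => //.
    by have := hcols 0 isT; rewrite addn0.
  have hst : (sweep_start 20 k 10 <= 2 ^ N.of_nat L)%num.
    by apply: sweep_start_le; right; split; lia.
  have mono a b : (a <= b)%num -> N.to_nat a <= N.to_nat b by lia.
  case/andP: hn => hn1 ->; rewrite andbT; apply: leq_trans hn1.
  by rewrite -(to_nat_pow2 L); apply: mono.
apply: (IH (k + 1)%num _ _ hrest n i j L) => //; try lia.
have -> : N.to_nat (k + 1) = (N.to_nat k).+1 by lia.
exact: columns_ok_behead hcols.
Qed.

Definition small_primes : seq N :=
  [:: 53; 47; 43; 41; 37; 31; 29; 23; 19; 17; 13; 11; 7; 5; 3; 2]%num.

(* Found by search: thinned greedily (ratio of consecutive entries mostly about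
   1.23) while keeping the sweeps successful. *)
Definition sparse_primes : seq N :=
  [:: 2; 3; 5; 7; 11; 13; 17; 19; 23; 29; 31; 37; 41; 43; 47; 53; 59; 71; 83;
      101; 113; 137; 167; 199; 241; 293; 359; 439; 523; 641; 773; 947; 1153;
      1409; 1723; 2113; 2593; 3181; 3889; 4759; 5839; 7159; 8783; 10771; 13217;
      16217; 19891; 24407; 29947; 36749; 45083; 55313; 67883; 83299; 102229;
      125453; 153953; 188941; 231877; 296287; 402091; 603133; 1067069;
      2591453]%num.

Definition trial_prime (p : N) : bool :=
  (1 <? p)%num && trial_division 2000 p 2.

Lemma trial_prime_list ps : all trial_prime ps -> prime_list ps.
Proof.
apply: sub_all => p /andP [/N.ltb_lt p1 h].
exact: trial_division_prime p1 h.
Qed.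

Lemma small_primesP : prime_list small_primes.
Proof. apply: trial_prime_list; by vm_compute. Qed.

Lemma sparse_primesP : prime_list sparse_primes.
Proof. apply: trial_prime_list; by vm_compute. Qed.

Transparent scale.

(** Columns up to 25 are enough: for [n <= 2^10], [harmonic_large_lt1] with [b = 10] takes care of
    [k > 25]. *)
Lemma rows_checked :
  check_rows (2 ^ 10) small_primes 0 (nseq 25 (0, 0)%num) (columns 25 40).
Proof. by vm_compute. Qed.

(** The 52 columns come from [4k <= 9L + 10] with [L <= 22]. *)
Lemma sweeps_checked :
  check_sweeps 600 sparse_primes (2 ^ 23) 1 (columns 52 40).
Proof. by vm_compute. Qed.

(** * Large [k], and the conclusion *)

(** In the expansion of [(1 + 1/k)^k] the [j]-th term is at most [1/j! <= 2/2^j], and the sum up to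
    [j = m] is at most [3 - 2/2^m]. *)
Lemma expnS_le3 k : k.+1 ^ k <= 3 * k ^ k.
Proof.
have bound j : j <= k -> 2 ^ j * ('C(k, j) * k ^ (k - j)) <= 2 * k ^ k.
  move=> jk; have -> : k ^ k = k ^ j * k ^ (k - j) by rewrite -expnD subnKC.
  rewrite !mulnA leq_mul2r; apply/orP; right.
  have h2 : 2 ^ j <= 2 * j`!.
    elim: j {jk} => // j IH; rewrite expnS factS.
    case: j IH => // j IH; apply: leq_trans (leq_mul (leqnn 2) IH) _.
    by rewrite leq_mul2l /= leq_mul.
  have hk : 'C(k, j) * j`! <= k ^ j.
    rewrite bin_ffact; elim: j jk {h2} => // j IH jk.
    by rewrite ffactnSr expnSr leq_mul ?IH ?leq_subr // ltnW.
  apply: leq_trans (leq_mul h2 (leqnn _)) _.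
  by rewrite -mulnA leq_mul2l /= mulnC.
have partial m : m <= k ->
    2 ^ m * (\sum_(j < m.+1) 'C(k, j) * k ^ (k - j)) <= (3 * 2 ^ m - 2) * k ^ k.
  elim: m => [|m IH] mk; first by rewrite big_ord1 bin0 subn0 !mul1n.
  rewrite big_ord_recr /= mulnDr.
  have := bound _ mk; have := IH (ltnW mk); have : 0 < 2 ^ m by rewrite expn_gt0.
  rewrite expnS; move: (2 ^ m) (k ^ k) (\sum_(j < _) _) ('C(_, _) * _) => p K s t.
  move=> p0 h1 h2; have -> : 3 * (2 * p) - 2 = 2 * (3 * p - 2) + 2 by lia.
  by rewrite mulnDl -!mulnA; lia.
have h := partial k (leqnn k); rewrite -(addn1 k) expnDn.
under eq_bigr do rewrite exp1n muln1.
rewrite -(leq_pmul2l (_ : 0 < 2 ^ k)) ?expn_gt0 //; apply: leq_trans h _.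
by rewrite mulnA leq_mul2r mulnC; apply/orP; right; lia.
Qed.

Lemma expn_lt_fact k : 0 < k -> k ^ k < 3 ^ k * k`!.
Proof.
elim: k => // -[_ _ //|k IH _].
rewrite factS expnS [3 ^ _]expnS.
have := IH isT; have := expnS_le3 k.+1.
move: (k.+2 ^ k.+1) (k.+1 ^ k.+1) (3 ^ k.+1) (k.+1)`! => a b c d h1 h2; nia.
Qed.

(** The last hypothesis says that the bound on the harmonic number is at most [k/3], and
    [(k/3)^k < k!]. *)
Lemma harmonic_large_lt1 n k b :
  ((esym_poly (iota 1 (2 ^ 10)))`_1 <= 152%:R / 20%:R)%R ->
  10 <= b -> n <= 2 ^ b -> 3 * (2 + 15 * b) <= 20 * k ->
  ((esym_poly (iota 1 n))`_k < 1)%R.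
Proof.
move=> h0 hb hn hk; apply: (esym_lt1 _ _ (2 + 15 * b) 20) => //.
  exact: le_trans (harmonic_le _ _ hn) (harmonic_pow2 _ hb h0).
have k0 : 0 < k by lia.
rewrite -(ltn_pmul2l (_ : 0 < 3 ^ k)) ?expn_gt0 // -expnMn.
apply: leq_ltn_trans (_ : (20 * k) ^ k < _); first by rewrite leq_exp2r.
rewrite expnMn mulnA [X in _ < X]mulnC ltn_pmul2l ?expn_gt0 //.
exact: expn_lt_fact.
Qed.

Lemma nseq_row_ok s : row_ok 0 (nseq s (0, 0)%num).
Proof.
move=> j; rewrite size_nseq nth_nseq => hj; rewrite hj /encloses.
by rewrite /esym_poly big_nil coef1 mulr0 lexx.
Qed.

Local Open Scope ring_scope.

Theorem theorem1p1 (n i k : nat) :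
  (2 <= n)%N -> (1 <= k)%N -> (k < n)%N -> (1 <= i)%N -> (i <= n)%N ->
  S n i k \is a Num.int -> (n, i, k) = (2, 2, 1)%N \/ (n, i, k) = (4, 4, 2)%N.
Proof.
move=> n2 k1 kn i1 hin; rewrite S_esym => hint.
have hi : (0 < i <= n)%N by rewrite i1.
have D0 : (0 < scale)%num by [].
have [hrows h10] := check_rowsP (2 ^ 10) small_primes 0 _ _ D0 small_primesP
  (columns_correct 25 40) (nseq_row_ok 25) rows_checked.
rewrite add0n in h10.
have lt1 : (esym_poly (iota 1 n))`_k < 1 -> False.
  by move=> /(omit_not_int _ _ _ hi kn); rewrite hint.
have [nsmall|nlarge] := leqP n (2 ^ 10).
  have [k25|k25] := leqP k 25; last first.
    case: lt1; apply: (harmonic_large_lt1 n k 10) => //; lia.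
  have := hrows n i k; rewrite add0n nsmall size_columns hint.
  case=> //; try lia.
  rewrite /exceptional => /orP [] /andP [/andP [/N.eqb_eq a /N.eqb_eq b] /N.eqb_eq c].
    by left; congr (_, _, _); lia.
  by right; congr (_, _, _); lia.
have n0 : (0 < n)%N by lia.
have /andP [hL1 hL2] := @trunc_log_bounds 2 n isT n0.
set L := trunc_log 2 n in hL1 hL2.
have L10 : (10 <= L)%N by apply: trunc_log_max => //; apply: ltnW.
(* From [4k > 9L + 10] follows [3 (2 + 15 (L+1)) <= 20k], as needed for [n < 2^(L+1)]. *)
have [kL|kL] := leqP (4 * k) (9 * L + 10); last first.
  by case: lt1; apply: (harmonic_large_lt1 n k L.+1) => //; [exact: leqW|exact: ltnW|lia].
have [L23|L22] := leqP 23 L.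
  (* The bound on [k] matches since [9 (L - 23) + 217 = 9L + 10]. *)
  have := large_not_int (L - 23) n i k; rewrite hint.
  rewrite subnK // (_ : (L - 23 + 24 = L.+1)%N); last lia.
  rewrite hL1 hL2 => H; suff : ~~ true by [].
  by apply: H => //; lia.
have one0 : (0 < 1)%num by lia.
have := check_sweepsP 600 sparse_primes (2 ^ 23) 1 _ one0 sparse_primesP
  (columns_correct 52 40) sweeps_checked n i k L L10.
rewrite hint hL1 size_columns => H; suff : ~~ true by [].
apply: H => //; last lia.
apply: leq_trans hL2 _.
by rewrite (to_nat_pow2 23 : N.to_nat (2 ^ 23) = _) leq_exp2l.
Qed.
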